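(* The competitive ratio of the online algorithm ON (described in the context) is less than $2$, i.e. $$\max_{\sigma\in\boldsymbol\sigma,\ \rho\in\boldsymbol\rho}\ \frac{T_{\mathrm{ON}}(\sigma,\rho)}{T_O(\sigma,\rho)}<2 ,$$ where $\boldsymbol\sigma$ is the set of all possible energy arrival sequences at the transmitter and $\boldsymbol\rho$ is the set of all possible on-time arrival sequences at the receiver.
   Context: Model. A transmitter energy arrival sequence $\sigma$ consists of instants $0=\tau_0<\tau_1<\cdots$ and amounts $\mathcal{E}_i>0$; $\mathcal{E}(t)=\sum_{i:\tau_i\le t}\mathcal{E}_i$. A receiver sequence $\rho$ consists of instants $0=r_0<r_1<\cdots$ and amounts $\Gamma_i>0$ of receiver on-time; $\Gamma(t)=\sum_{i:r_i\le t}\Gamma_i$. Batteries at both ends are infinite. Rate function. $g:[0,\infty)\to[0,\infty)$ is monotonically increasing, $g(0)=0$, $\lim_{p\to\infty}g(p)=\infty$, $g$ is concave, and $g(p)/p$ is convex and monotonically decreasing with $\lim_{p\to\infty}g(p)/p=0$. Offline problem. A policy uses power $p_i\ge0$ on $[s_i,s_{i+1}]$, $i=1,\dots,N$, with $0\le s_1<\cdots<s_{N+1}$; the receiver is on exactly when the power is nonzero. $U(t),B(t),C(t)$ are the energy used, the bits sent (at rate $g(\text{power})$) and the receiver on-time used up to time $t$. Given $B_0>0$, minimize the finish time $T=s_{N+1}$ subject to $B(T)=B_0$, $U(t)\le\mathcal{E}(t)$ and $C(t)\le\Gamma(t)$ for all $t\in[0,T]$. $T_O(\sigma,\rho)$ is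 the finish time of the optimal offline algorithm (which knows all arrivals in advance), i.e. the minimum value of this problem; the ratio in the claim is taken over inputs for which this problem has a solution. Algorithm ON (uses only causal information). Let $T_{\mathrm{start}}=\min\{t:\Gamma(t)\,g(\mathcal{E}(t)/\Gamma(t))\ge B_0\}$. From $T_{\mathrm{start}}$ transmit with the power $l_1$ given by $\frac{\mathcal{E}(T_{\mathrm{start}})}{l_1}g(l_1)=B_0$. At every transmitter energy arrival epoch $\tau_j>T_{\mathrm{start}}$ before completion, change the power to the value $l$ given by $\frac{E_{\mathrm{rem}}(\tau_j)}{l}g(l)=B_{\mathrm{rem}}(\tau_j)$, where $E_{\mathrm{rem}}(\tau_j)$ is the energy left at the transmitter at time $\tau_j$ (including the new arrival) and $B_{\mathrm{rem}}(\tau_j)$ is the number of bits remaining to be sent. The power is not changed at receiver arrivals after $T_{\mathrm{start}}$. Transmission stops when $B_0$ bits are sent; the finish time is $T_{\mathrm{ON}}(\sigma,\rho)$.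
   Formalization: The maximum is not attained (the supremum of the ratios equals 2), so the claim is proved as: for every pair of arrival sequences whose instants do not accumulate and whose offline problem has a solution, ON finishes and T_ON/T_O < 2. *)

(* Defs.v *)
From mathcomp Require Import all_boot all_order all_algebra.
From mathcomp Require Import all_classical all_reals all_analysis.
Set Implicit Arguments.
Unset Strict Implicit.
Unset Printing Implicit Defensive.
Import Order.TTheory GRing.Theory Num.Theory.
Import numFieldNormedType.Exports.
Local Open Scope classical_set_scope.
Local Open Scope ring_scope.

Definition is_min (R : realType) (A : set R) (x : R) : Prop := A x /\ lbound A x.

(* [g] is a total function on [R]; only its values on [0, +oo[ matter.
   Monotonicity is required in the weak sense only; with the concavity of [g],
   the convexity of [g p / p] and the limits, it forces strict monotonicity. *)
Record rate_function (R : realType) (g : R -> R) : Prop := RateFunction {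
  rate_ge0 : forall p, 0 <= p -> 0 <= g p ;
  rate_incr : {in `[0, +oo[ &, {homo g : p q / p <= q}} ;
  rate0 : g 0 = 0 ;
  rate_cvgy : g p @[p --> +oo%R] --> +oo%R ;
  rate_concave : convex_function (`[0, +oo[%classic : set R) (fun p => - g p) ;
  rate_ratio_convex :
    convex_function (`]0, +oo[%classic : set R) (fun p => g p / p) ;
  rate_ratio_decr :
    {in `]0, +oo[ &, {homo (fun p => g p / p) : p q / p <= q >-> q <= p}} ;
  rate_ratio_cvg0 : g p / p @[p --> +oo%R] --> (0 : R) }.

(* An arrival sequence with infinitely many arrivals ([nb_arrivals = None]) or
   with [n] arrivals, numbered [0, ..., n - 1] ([nb_arrivals = Some n]); [instant]
   and [amount] are irrelevant at other indices. Arrivals do not accumulate,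
   so that the cumulated amounts are finite sums and each arrival has a next
   one, if any. *)
Definition in_range (nb : option nat) (i : nat) : bool :=
  if nb is Some n then (i < n)%N else true.

Record arrivals (R : realType) := Arrivals {
  nb_arrivals : option nat ;
  instant : nat -> R ;
  amount : nat -> R ;
  arrival0 : in_range nb_arrivals 0 ;
  instant0 : instant 0 = 0 ;
  instant_lt : forall i, in_range nb_arrivals i.+1 -> instant i < instant i.+1 ;
  instant_fin : forall t,
    finite_set [set i | in_range nb_arrivals i /\ instant i <= t] ;
  amount_gt0 : forall i, in_range nb_arrivals i -> 0 < amount i }.

Definition arrival (R : realType) (a : arrivals R) (i : nat) : bool :=
  in_range (nb_arrivals a) i.

Definition cumul (R : realType) (a : arrivals R) (t : R) : R :=
  \sum_(i \in [set i | arrival a i /\ instant a i <= t]) amount a i.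

(* Pieces are numbered from 0: power [power i] is used on
   [[switch i, switch i.+1]] for [i < nb_pieces]. *)
Record policy (R : realType) := Policy {
  nb_pieces : nat ;
  power : nat -> R ;
  switch : nat -> R ;
  power_ge0 : forall i, (i < nb_pieces)%N -> 0 <= power i ;
  switch_ge0 : 0 <= switch 0 ;
  switch_lt : forall i, (i < nb_pieces)%N -> switch i < switch i.+1 }.

Section Offline.
Context {R : realType}.
Implicit Types (g : R -> R) (P : policy R) (sigma rho : arrivals R) (t T : R).

Definition finish_time P : R := switch P (nb_pieces P).

(* Length of the part of the [i]-th piece that lies in [0, t]. *)
Definition elapsed P (i : nat) t : R :=
  Num.max 0 (Num.min t (switch P i.+1) - switch P i).

Definition energy_used P t : R :=
  \sum_(i < nb_pieces P) power P i * elapsed P i t.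

Definition bits_sent g P t : R :=
  \sum_(i < nb_pieces P) g (power P i) * elapsed P i t.

Definition on_time_used P t : R :=
  \sum_(i < nb_pieces P | power P i != 0) elapsed P i t.

Definition feasible g (B0 : R) sigma rho P : Prop :=
  bits_sent g P (finish_time P) = B0 /\
  forall t, 0 <= t <= finish_time P ->
    energy_used P t <= cumul sigma t /\ on_time_used P t <= cumul rho t.

Definition is_offline_time g (B0 : R) sigma rho T : Prop :=
  is_min [set finish_time P | P in [set P | feasible g B0 sigma rho P]] T.

End Offline.

Section Online.
Context {R : realType}.
Implicit Types (g : R -> R) (sigma rho : arrivals R) (t T Ts u b l E B : R).

Definition is_start_time g (B0 : R) sigma rho Ts : Prop :=
  is_min [set t | 0 <= t /\
                  cumul rho t * g (cumul sigma t / cumul rho t) >= B0] Ts.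

(* [ON_power g E B l]: [l] is the power with which energy [E] is exhausted
   exactly when [B] bits have been sent. *)
Definition ON_power g E B l : Prop := 0 < l /\ E / l * g l = B.

(* [ON_run g B0 sigma t j u b T]: at time [t] the power is (re)computed, [u] is
   the energy used and [b] the number of bits sent so far, [j] is the index of
   the first transmitter arrival after [t] (if there is one); from this state,
   the [B0] bits are completely sent at time [T]. *)
Inductive ON_run g (B0 : R) sigma : R -> nat -> R -> R -> R -> Prop :=
| ON_finish t j u b l T :
    ON_power g (cumul sigma t - u) (B0 - b) l ->
    t <= T -> b + g l * (T - t) = B0 ->
    (arrival sigma j -> T <= instant sigma j) ->
    ON_run g B0 sigma t j u b T
| ON_update t j u b l T :
    ON_power g (cumul sigma t - u) (B0 - b) l ->
    arrival sigma j ->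
    b + g l * (instant sigma j - t) < B0 ->
    ON_run g B0 sigma (instant sigma j) j.+1
      (u + l * (instant sigma j - t)) (b + g l * (instant sigma j - t)) T ->
    ON_run g B0 sigma t j u b T.

Definition is_ON_time g (B0 : R) sigma rho T : Prop :=
  exists Ts j, [/\ is_start_time g B0 sigma rho Ts,
    (forall i, arrival sigma i -> (instant sigma i <= Ts) = (i < j)%N),
    (forall i, (i < j)%N -> arrival sigma i) &
    ON_run g B0 sigma Ts j 0 0 T].

End Online.

(* Main.v *)
(* Let E be the transmitter energy arrived strictly before the offline finish
   time TO, and h(p) = g(p)/p, which is strictly decreasing. By Jensen, the
   offline optimum forces B0 <= f(E, C) with f(E, C) = C g(E/C) increasing in
   both arguments and C <= TO the receiver on-time arrived strictly before TO;
   hence ON starts strictly before TO. The powers of ON increase, so when it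
   computes power l after spending u and sending b bits, u h(l) <= b. At the
   last update t < TO this gives E h(l) <= b + (E - u) h(l) = B0 <= E h(E/TO),
   that is l >= E/TO, so the remaining time (E - u)/l is at most TO. Updates
   after TO only shorten it, whence TON <= t + TO < 2 TO. *)
Require Import Defs.
From mathcomp Require Import all_boot all_order all_algebra.
From mathcomp Require Import all_classical all_reals all_analysis.
From mathcomp Require Import ring lra.
Set Implicit Arguments.
Unset Strict Implicit.
Unset Printing Implicit Defensive.
Import Order.TTheory GRing.Theory Num.Theory.
Local Open Scope ring_scope.

(** * The rate function, its efficiency [g p / p], and the bits obtainable from given energy and
    on-time *)

Section RateFunction.
Context {R : realType}.
Implicit Types (p q a b c x y E C B l : R).

Lemma convex_functionP (D : set R) (f : R -> R) :
  convex_function (D : set (convex_lmodType R^o)) f ->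
  forall a b x y, D x -> D y -> 0 <= a -> 0 <= b -> a + b = 1 ->
  f (a * x + b * y) <= a * f x + b * f y.
Proof.
move=> cf a b x y Dx Dy a0 b0 ab.
have a1 : a <= 1 by lra.
have := cf (Itv01 a0 a1) x y; rewrite !inE => /(_ Dx Dy).
have -> : b = 1 - a by lra.
by [].
Qed.

Context {g : R -> R}.
Hypothesis hg : rate_function g.

(** If [g p] were 0, the decreasing ratio would keep [g] from being positive beyond [p], against its
    divergence. *)
Lemma rate_gt0 p : 0 < p -> 0 < g p.
Proof.
move=> p0; rewrite lt_neqAle (rate_ge0 hg) ?(ltW p0)// andbT eq_sym.
apply/eqP => gp0.
have /cvgryPgt/(_ 0) ev := rate_cvgy hg.
have [q pq gq] := pinfty_ex_gt (num_real p) ev.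
have := rate_ratio_decr hg (x := p) (y := q).
rewrite !in_itv/= !andbT => /(_ p0 (lt_trans p0 pq) (ltW pq)).
by rewrite gp0 mul0r leNgt divr_gt0// (lt_trans p0 pq).
Qed.

Lemma rate_ratio_gt0 p : 0 < p -> 0 < g p / p.
Proof. by move=> p0; rewrite divr_gt0// rate_gt0. Qed.

Lemma rate_le p q : 0 <= p -> p <= q -> g p <= g q.
Proof.
move=> p0 pq; apply: (rate_incr hg) => //; rewrite in_itv/= andbT//.
exact: le_trans pq.
Qed.

Lemma rate_ratio_le p q : 0 < p -> p <= q -> g q / q <= g p / p.
Proof.
move=> p0 pq; apply: (rate_ratio_decr hg) => //; rewrite in_itv/= andbT//.
exact: lt_le_trans pq.
Qed.

Lemma rate_ratio_small p c : 0 < c -> exists2 q, p < q & g q / q < c.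
Proof.
move=> c0; have ev := cvgr_lt _ (rate_ratio_cvg0 hg) _ c0.
exact: (pinfty_ex_gt (num_real p) (ev _)).
Qed.

(** A convex function that does not drop from [p] to [q] cannot be lower at a later [z]; but the
    ratio is positive and tends to 0. *)
Lemma rate_ratio_lt p q : 0 < p -> p < q -> g q / q < g p / p.
Proof.
move=> p0 pq; rewrite ltNge; apply/negP => hpq.
have q0 := lt_trans p0 pq.
have [z qz hz] := rate_ratio_small q (rate_ratio_gt0 q0).
have z0 := lt_trans q0 qz.
have zp : 0 < z - p by lra.
have := convex_functionP (rate_ratio_convex hg) (a := (z - q) / (z - p))
   (b := (q - p) / (z - p)) (x := p) (y := z).
rewrite /= !in_itv/= !andbT => /(_ p0 z0).
have -> : (z - q) / (z - p) * p + (q - p) / (z - p) * z = q by field; lra.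
have a0 : 0 < (z - q) / (z - p) by rewrite divr_gt0//; lra.
have b0 : 0 < (q - p) / (z - p) by rewrite divr_gt0//; lra.
move=> /(_ (ltW a0) (ltW b0)) H.
have ab : (z - q) / (z - p) + (q - p) / (z - p) = 1 by field; lra.
move: {H}(H ab); move: a0 b0 ab hz hpq.
move: (g p / p) (g q / q) (g z / z) ((z - q) / (z - p)) ((q - p) / (z - p)).
move=> hp hq hz a b a0 b0 ab ? ?; nra.
Qed.

Lemma rate_ratio_le_inv p q : 0 < p -> 0 < q -> g q / q <= g p / p -> p <= q.
Proof.
move=> p0 q0; rewrite leNgt => h; rewrite leNgt; apply: contra h.
exact: rate_ratio_lt.
Qed.

(* Monotonicity of [g p] and of [g p / p] already makes [g p / p] continuous,
   so its value at the supremum of [[set p | c <= g p / p]] is exactly [c]. *)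
Lemma rate_ratio_solve p c : 0 < p -> 0 < c -> c <= g p / p ->
  exists2 l, p <= l & g l / l = c.
Proof.
move=> p0 c0 cp; pose S : set R := [set l | p <= l /\ c <= g l / l]%classic.
have Sp : S p by split.
have [q pq hq] := rate_ratio_small p c0.
have Sub : ubound S q.
  move=> l [pl cl]; rewrite leNgt; apply/negP => ql.
  have := rate_ratio_le (lt_trans p0 pq) (ltW ql); lra.
have hS : has_sup S by split; [exists p | exists q].
have pl : p <= sup S by exact: sup_upper_bound Sp.
exists (sup S) => //; set l := sup S in pl *.
have l0 : 0 < l := lt_le_trans p0 pl.
apply/eqP; rewrite eq_le; apply/andP; split; rewrite leNgt; apply/negP => hl.
  (* [y] is [g l / c], which exceeds [l]; since [g y >= g l], its ratio is still at least [c], so it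
     lies in [S] above the supremum. *)
  pose y := l * (g l / l) / c.
  have ly : l < y by rewrite /y ltr_pdivlMr// ltr_pM2l.
  have y0 := lt_trans l0 ly.
  have : S y.
    split; first exact: le_trans (ltW ly).
    rewrite ler_pdivlMr//.
    have -> : c * y = g l by rewrite /y; field; lra.
    by apply: rate_le; lra.
  by move/(sup_upper_bound hS); rewrite leNgt ly.
(* Each [s] in [S] satisfies [c * s <= g s <= g l], while [hl] gives [g l / c < l]: the supremum
   would lie below itself. *)
have : sup S <= g l / c.
  apply: ge_sup; first by exists p.
  move=> s Ss; have [ps cs] := Ss; have s0 := lt_le_trans p0 ps.
  rewrite ler_pdivlMr// mulrC -ler_pdivlMr//.
  apply: le_trans cs _; rewrite ler_pM2r ?invr_gt0//.
  by apply: rate_le; [lra | exact: sup_upper_bound Ss].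
rewrite -/l ler_pdivlMr// leNgt => /negP; apply.
by rewrite mulrC -ltr_pdivrMr.
Qed.

(** The perspective of [g]: the bits sent by spreading energy [E] evenly over on-time [C]. It is 0
    at [C = 0]. *)
Definition capacity E C : R := C * g (E / C).

Lemma capacityE E C : 0 < E -> 0 < C ->
  capacity E C = E * (g (E / C) / (E / C)).
Proof. by move=> E0 C0; rewrite /capacity; field; lra. Qed.

(** Jensen's inequality for the concave [g], with weights proportional to [C1] and [C2]. *)
Lemma capacityD E1 E2 C1 C2 : 0 <= E1 -> 0 <= E2 -> 0 < C1 -> 0 < C2 ->
  capacity E1 C1 + capacity E2 C2 <= capacity (E1 + E2) (C1 + C2).
Proof.
move=> E10 E20 C10 C20; rewrite /capacity.
have C0 : 0 < C1 + C2 by lra.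
have := convex_functionP (rate_concave hg) (a := C1 / (C1 + C2))
   (b := C2 / (C1 + C2)) (x := E1 / C1) (y := E2 / C2).
rewrite /= !in_itv/= !andbT => H.
have := H (divr_ge0 E10 (ltW C10)) (divr_ge0 E20 (ltW C20)).
move=> {H} /(_ (divr_ge0 (ltW C10) (ltW C0)) (divr_ge0 (ltW C20) (ltW C0))).
rewrite -mulrDl divff ?gt_eqF// => /(_ erefl).
have -> : C1 / (C1 + C2) * (E1 / C1) + C2 / (C1 + C2) * (E2 / C2)
   = (E1 + E2) / (C1 + C2) by field; lra.
move: (g (E1 / C1)) (g (E2 / C2)) (g ((E1 + E2) / (C1 + C2))) => v w u.
rewrite -(ler_pM2l C0).
have -> : (C1 + C2) * (C1 / (C1 + C2) * - v + C2 / (C1 + C2) * - w) =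
   - (C1 * v + C2 * w) by field; lra.
by rewrite mulrN lerN2.
Qed.

(** In [E] this is monotonicity of [g]; in [C] it comes from the decreasing ratio, through the form
    [E * (g p / p)] at [p = E / C]. *)
Lemma capacity_le E1 E2 C1 C2 : 0 <= E1 -> E1 <= E2 -> 0 <= C1 -> C1 <= C2 ->
  capacity E1 C1 <= capacity E2 C2.
Proof.
move=> E10 E12 C10 C12; have E20 : 0 <= E2 by lra.
have [C10'|C1n] := eqVneq C1 0.
  rewrite C10' /capacity mul0r mulr_ge0 ?(le_trans C10 C12)//.
  by rewrite (rate_ge0 hg)// divr_ge0// (le_trans C10 C12).
have C1p : 0 < C1 by rewrite lt_def C1n.
have C2p : 0 < C2 by lra.
apply: (@le_trans _ _ (capacity E2 C1)).
  rewrite /capacity ler_pM2l//; apply: rate_le; first by rewrite divr_ge0.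
  by rewrite ler_pM2r ?invr_gt0.
have [->|E2n] := eqVneq E2 0.
  by rewrite /capacity !mul0r (rate0 hg) !mulr0.
have E2p : 0 < E2 by rewrite lt_def E2n.
rewrite !capacityE// ler_pM2l//; apply: rate_ratio_le; first exact: divr_gt0.
by rewrite ler_pM2l// lef_pV2.
Qed.

End RateFunction.

(** * Offline policies: regularity in time and the Jensen bound on the bits sent *)

Section Policy.
Context {R : realType}.
Implicit Types (P : policy R) (t T K M : R).

Lemma elapsed_ge0 P i t : 0 <= elapsed P i t.
Proof. by rewrite /elapsed le_max lexx. Qed.

Lemma elapsed_lip P i t T : t <= T -> elapsed P i T <= elapsed P i t + (T - t).
Proof.
move=> tT; rewrite /elapsed ge_max; apply/andP; split.
  by rewrite addr_ge0 ?subr_ge0// le_max lexx.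
suff : Num.min T (switch P i.+1) <= Num.min t (switch P i.+1) + (T - t).
  have : Num.min t (switch P i.+1) - switch P i <=
    Num.max 0 (Num.min t (switch P i.+1) - switch P i) by rewrite le_max lexx orbT.
  lra.
by rewrite /Num.min; do 2 case: ifP => /negP; lra.
Qed.

Lemma energy_used_ge0 P t : 0 <= energy_used P t.
Proof.
by apply: sumr_ge0 => i _; rewrite mulr_ge0 ?elapsed_ge0// power_ge0.
Qed.

Lemma on_time_used_ge0 P t : 0 <= on_time_used P t.
Proof. by apply: sumr_ge0 => i _; rewrite elapsed_ge0. Qed.

Lemma on_time_used_le P : on_time_used P (finish_time P) <= finish_time P.
Proof.
apply: (@le_trans _ _ (\sum_(i < nb_pieces P) (switch P i.+1 - switch P i))).
  rewrite /on_time_used big_mkcond; apply: ler_sum => i _.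
  have si := switch_lt (ltn_ord i).
  case: ifP => _; last by lra.
  by rewrite /elapsed ge_max subr_ge0 (ltW si) lerD2r ge_min lexx orbT.
rewrite -(big_mkord xpredT (fun i => switch P i.+1 - switch P i)) telescope_sumr//.
by have := switch_ge0 P; rewrite /finish_time; lra.
Qed.

Lemma sum_elapsed_lip P (w : nat -> R) :
  (forall i, (i < nb_pieces P)%N -> 0 <= w i) -> forall t T, t <= T ->
  \sum_(i < nb_pieces P) w i * elapsed P i T <=
  \sum_(i < nb_pieces P) w i * elapsed P i t +
  (\sum_(i < nb_pieces P) w i) * (T - t).
Proof.
move=> w0 t T tT; rewrite mulr_suml -big_split/=; apply: ler_sum => i _.
by rewrite -mulrDr ler_wpM2l ?w0// elapsed_lip.
Qed.

Lemma on_time_usedE P t : on_time_used P t =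
  \sum_(i < nb_pieces P) (power P i != 0)%:R * elapsed P i t.
Proof.
rewrite /on_time_used big_mkcond/=; apply: eq_bigr => i _.
by case: ifP => _; rewrite ?mul1r ?mul0r.
Qed.

(** The one-sided Lipschitz condition rules out an upward jump at [T], so a bound valid just before
    [T] persists there. *)
Lemma le_left_limit (f : R -> R) M K t0 T : 0 <= M -> t0 < T ->
  (forall t, t <= T -> f T <= f t + M * (T - t)) ->
  (forall t, t0 <= t -> t < T -> f t <= K) -> f T <= K.
Proof.
move=> M0 t0T lipf fK; rewrite leNgt; apply/negP => KfT.
(* Over a final stretch of length [d] the gain [M * d] stays below [f T - K]; [M + 1] keeps the
   quotient meaningful when [M = 0]. *)
pose d := Num.min ((f T - K) / (M + 1)) (T - t0).
have d0 : 0 < d by rewrite /d lt_min divr_gt0//; lra.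
have d1 : d * (M + 1) <= f T - K.
  by rewrite -ler_pdivlMr; [rewrite /d ge_min lexx | lra].
have d2 : d <= T - t0 by rewrite /d ge_min lexx orbT.
have h1 := lipf (T - d) ltac:(lra).
have h2 := fK (T - d) ltac:(lra) ltac:(lra).
nra.
Qed.

Lemma energy_used_left P K t0 T : t0 < T ->
  (forall t, t0 <= t -> t < T -> energy_used P t <= K) -> energy_used P T <= K.
Proof.
move=> t0T; apply: (le_left_limit _ t0T); last first.
  by move=> t; apply: sum_elapsed_lip => i; exact: power_ge0.
by apply: sumr_ge0 => i _; exact: power_ge0 (ltn_ord i).
Qed.

Lemma on_time_used_left P K t0 T : t0 < T ->
  (forall t, t0 <= t -> t < T -> on_time_used P t <= K) -> on_time_used P T <= K.
Proof.
move=> t0T; apply: (le_left_limit _ t0T); last first.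
  move=> t; rewrite !on_time_usedE.
  by apply: (@sum_elapsed_lip _ (fun i => (power P i != 0)%:R)).
by apply: sumr_ge0.
Qed.

(** Jensen over the pieces, added one by one: a piece of power [p] and length [d] has capacity
    [g p * d], and capacities are superadditive. *)
Lemma bits_sent_capacity (g : R -> R) (hg : rate_function g) P t :
  bits_sent g P t <= capacity (g := g) (energy_used P t) (on_time_used P t).
Proof.
rewrite /bits_sent /energy_used on_time_usedE.
(* The clause [c = 0 -> e = 0] handles the case of no on-time accumulated yet, which [capacityD]
   does not cover. *)
pose K b e c := [/\ 0 <= e, 0 <= c, c = 0 -> e = 0 &
  b <= capacity (g := g) e c].
set b := \sum_(i < _) g _ * _; set e := \sum_(i < _) _; set c := \sum_(i < _) _.
suff [] : K b e c by [].
rewrite /b /e /c; elim/big_rec3: _.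
  by split=> //; rewrite /capacity mul0r.
move=> i {c e b} c e b _ [e0 c0 ce bec].
have := elapsed_ge0 P i t; have := power_ge0 (ltn_ord i).
move: (power P i) (elapsed P i t) => p d p0 d0.
have [->|pn] := eqVneq p 0; first by rewrite (rate0 hg) !mul0r !add0r.
have [->|dn] := eqVneq d 0; first by rewrite !mulr0 !add0r.
have pp : 0 < p by rewrite lt_def pn.
have dp : 0 < d by rewrite lt_def dn.
have capd : capacity (g := g) (p * d) d = g p * d.
  by rewrite /capacity mulfK// mulrC.
rewrite mul1r; split; try by nra.
have [c00|cn] := eqVneq c 0.
  move: bec; rewrite c00 (ce c00) !addr0 capd /capacity mul0r; lra.
apply: le_trans (capacityD hg _ e0 dp _); last by rewrite lt_def cn.
  by rewrite capd lerD2l.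
by nra.
Qed.

End Policy.

(** * Cumulated arrivals as step functions of time *)

Section Arrivals.
Context {R : realType}.
Context (a : arrivals R).
Implicit Types (s t T : R) (i j N : nat).

Lemma downward_closed_count (P : pred nat) : (forall i, P i.+1 -> P i) ->
  (exists N, ~~ P N) -> exists j, forall i, P i = (i < j)%N.
Proof.
move=> PS exN; case: (ex_minnP exN) => j nPj minj; exists j => i.
case: ltnP => ij; last first.
  apply/negbTE; elim: i ij => [|i IH]; first by rewrite leqn0 => /eqP <-.
  rewrite leq_eqVlt => /orP[/eqP <- //|ij].
  by apply: contra (IH ij) => /PS.
by apply/negPn/negP => /minj; rewrite leqNgt ij.
Qed.

Lemma arrivalS i : arrival a i.+1 -> arrival a i.
Proof. by rewrite /arrival/in_range; case: (nb_arrivals a) => // n /ltnW. Qed.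

Lemma arrival_le i j : (i <= j)%N -> arrival a j -> arrival a i.
Proof.
elim: j => [|j IH]; first by rewrite leqn0 => /eqP ->.
by rewrite leq_eqVlt => /orP[/eqP -> //|ij /arrivalS]; exact: IH.
Qed.

Lemma instant_le i j : (i <= j)%N -> arrival a j -> instant a i <= instant a j.
Proof.
elim: j => [|j IH]; first by rewrite leqn0 => /eqP ->.
rewrite leq_eqVlt => /orP[/eqP -> //|ij aj].
exact: le_trans (IH ij (arrivalS aj)) (ltW (instant_lt aj)).
Qed.

Lemma arrival_bounded t : exists N, ~~ (arrival a N && (instant a N <= t)).
Proof.
apply: contrapT => H; apply: infinite_nat.
apply: sub_finite_set (instant_fin a t) => i _ /=.
by apply/andP; apply: contrapT => /negP ni; apply: H; exists i.
Qed.

(** [j] is the number of arrivals up to [t], hence also the index of the next one, if any; this form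
    suits finite and infinite sequences alike. *)
Definition counts t j := forall i, arrival a i && (instant a i <= t) = (i < j)%N.

Lemma counts_ex t : exists j, counts t j.
Proof.
apply: downward_closed_count (arrival_bounded t) => i /andP[ai ti].
by rewrite arrivalS// (le_trans (ltW (instant_lt ai))).
Qed.

Lemma cumulE t j : counts t j -> cumul a t = \sum_(i < j) amount a i.
Proof.
move=> tj; rewrite fsbig_ord /cumul; apply: eq_fsbigl.
by apply/seteqP; split=> i /=; [move/andP; rewrite tj | rewrite -tj => /andP].
Qed.

Lemma counts_arrival t j i : counts t j -> (i < j)%N -> arrival a i.
Proof. by move=> tj; rewrite -tj => /andP[]. Qed.

Lemma counts_lt t j : counts t j -> arrival a j -> t < instant a j.
Proof. by move=> tj aj; have := tj j; rewrite ltnn aj ltNge => /= ->. Qed.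

Lemma counts_instant j : arrival a j -> counts (instant a j) j.+1.
Proof.
move=> aj i; rewrite ltnS; case: leqP => ij.
  by rewrite (arrival_le ij)// instant_le.
apply/negP => /andP[ai]; rewrite leNgt => /negP; apply.
apply: lt_le_trans (instant_le ij ai).
exact: instant_lt (arrival_le ij ai).
Qed.

Lemma counts_stable t j s : counts t j -> t <= s ->
  (arrival a j -> s < instant a j) -> counts s j.
Proof.
move=> tj ts sj i; case: ltnP => ij.
  by have := ij; rewrite -tj => /andP[-> /le_trans ->].
apply/negP => /andP[ai]; rewrite leNgt => /negP; apply.
exact: lt_le_trans (sj (arrival_le ij ai)) (instant_le ij ai).
Qed.

Lemma cumul_stable t j s : counts t j -> t <= s ->
  (arrival a j -> s < instant a j) -> cumul a s = cumul a t.
Proof.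
by move=> tj ts sj; rewrite (cumulE tj) (cumulE (counts_stable tj ts sj)).
Qed.

Lemma cumul_le s t : s <= t -> cumul a s <= cumul a t.
Proof.
move=> st; have [i si] := counts_ex s; have [j tj] := counts_ex t.
have ij : (i <= j)%N.
  rewrite leqNgt; apply/negP => ji; have := ji; rewrite -si => /andP[aj js].
  by have := tj j; rewrite aj (le_trans js st) ltnn.
rewrite (cumulE si) (cumulE tj) -!(big_mkord xpredT (amount a)).
rewrite [leRHS](big_cat_nat (leq0n i) ij)//= lerDl big_nat_cond; apply: sumr_ge0 => k.
by rewrite andbT => /andP[_ kj]; apply/ltW/amount_gt0; exact: counts_arrival kj.
Qed.

Lemma cumul_gt0 t : 0 <= t -> 0 < cumul a t.
Proof.
move=> t0; have [j tj] := counts_ex t; rewrite (cumulE tj).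
case: j tj => [|j] tj.
  by have := tj 0%N; rewrite /arrival arrival0 instant0 t0.
rewrite big_ord_recl ltr_wpDr//; last exact: amount_gt0 (arrival0 a).
by apply: sumr_ge0 => i _; apply/ltW/amount_gt0; exact: (counts_arrival tj).
Qed.

(** Right-continuity: the witness is the next arrival, or any later time once arrivals are
    exhausted. *)
Lemma cumul_right t : exists2 t', t < t' &
  forall s, t <= s -> s < t' -> cumul a s = cumul a t.
Proof.
have [j tj] := counts_ex t.
have [aj|aj] := boolP (arrival a j).
  exists (instant a j); first exact: counts_lt tj aj.
  by move=> s ts sj; apply: cumul_stable tj ts _.
exists (t + 1) => [|s ts _]; first by rewrite ltrDl.
by apply: (cumul_stable tj ts) => aj'; rewrite aj' in aj.
Qed.

(** The witness is the last arrival strictly before [T]; there is one because arrival 0 occurs at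
    time 0. *)
Lemma cumul_left T : 0 < T -> exists2 t, 0 <= t < T &
  forall s, t <= s -> s < T -> cumul a s = cumul a t.
Proof.
move=> T0.
have [n Tn] : exists n, forall i, arrival a i && (instant a i < T) = (i < n)%N.
  apply: downward_closed_count => [i /andP[ai iT]|].
    by rewrite arrivalS// (lt_trans (instant_lt ai)).
  have [N nN] := arrival_bounded T; exists N.
  by apply: contra nN => /andP[-> /ltW].
case: n Tn => [|j] Tj; first by have := Tj 0%N; rewrite /arrival arrival0 instant0 T0.
have := ltnSn j; rewrite -Tj => /andP[aj jT].
have cj := counts_instant aj.
exists (instant a j).
  by rewrite jT andbT -(instant0 a) instant_le.
move=> s js sT; apply: (cumul_stable cj js) => aj1.
by apply: lt_le_trans sT _; rewrite leNgt; have := Tj j.+1; rewrite ltnn aj1 => /= ->.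
Qed.

End Arrivals.

(** * The powers chosen by ON, and bounds on its finish time *)

Section Online.
Context {R : realType} {g : R -> R} {B0 : R} {sigma : arrivals R}.
Hypothesis hg : rate_function g.
Implicit Types (t T u b x l E B TO : R) (j : nat).

Lemma ON_power_energy E B l : ON_power g E B l -> E = l * (B / g l).
Proof.
move=> [l0 <-]; have := rate_gt0 hg l0 => gl0; field.
by rewrite !gt_eqF.
Qed.

(** After time [x] at power [l], the energy left is just what [l] needs for the remaining bits. With
    [E'] at least that, the required efficiency is no larger than that of [l], and efficiency
    decreases with power. *)
Lemma ON_power_le E B l E' l' x : ON_power g E B l -> g l * x < B ->
  E - l * x <= E' -> ON_power g E' (B - g l * x) l' -> l <= l'.
Proof.
move=> pl xB EE' pl'; have [l0 _] := pl; have [l'0 _] := pl'.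
have gl0 := rate_gt0 hg l0; have gl'0 := rate_gt0 hg l'0.
apply: (rate_ratio_le_inv hg l0 l'0).
rewrite (ON_power_energy pl) (ON_power_energy pl') in EE'.
have D0 : 0 < (B - g l * x) / g l by rewrite divr_gt0//; lra.
have eqD : l * (B / g l) - l * x = l * ((B - g l * x) / g l).
  by field; rewrite gt_eqF.
rewrite eqD in EE'.
rewrite ler_pdivrMr// mulrAC ler_pdivlMr//.
have : l * g l' * (B - g l * x) <= l' * g l * (B - g l * x).
  have := EE'; rewrite -(ler_pM2r (mulr_gt0 gl0 gl'0)).
  have -> : l * ((B - g l * x) / g l) * (g l * g l') =
     l * g l' * (B - g l * x) by field; rewrite gt_eqF.
  have -> // : l' * ((B - g l * x) / g l') * (g l * g l') =
     l' * g l * (B - g l * x) by field; rewrite gt_eqF.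
by rewrite ler_pM2r; lra.
Qed.

Lemma ON_power_inj E B l l' : 0 < B ->
  ON_power g E B l -> ON_power g E B l' -> l = l'.
Proof.
move=> hB pl pl'; apply/eqP; rewrite eq_le.
rewrite (ON_power_le (x := 0) (E' := E) pl) ?mulr0 ?subr0//=.
by rewrite (ON_power_le (x := 0) (E' := E) pl') ?mulr0 ?subr0.
Qed.

(** The equation amounts to [g l' / l' = B / E]; the ratio at [l] is at least this value, so it is
    reached from [l] on. *)
Lemma ON_power_ex E B l : 0 < l -> 0 < E -> 0 < B -> B <= E * (g l / l) ->
  exists2 l', l <= l' & ON_power g E B l'.
Proof.
move=> l0 E0 hB Bl; have [||l' ll' hl'] := rate_ratio_solve hg l0 (c := B / E).
- exact: divr_gt0.
- by rewrite ler_pdivrMr// mulrC.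
exists l' => //; split; first exact: lt_le_trans ll'.
rewrite mulrAC -mulrA hl' mulrC divfK// gt_eqF//.
Qed.

Lemma ON_power_next E B l E' x : ON_power g E B l -> 0 <= x -> g l * x < B ->
  E - l * x <= E' -> exists2 l', l <= l' & ON_power g E' (B - g l * x) l'.
Proof.
move=> pl x0 xB EE'; have [l0 _] := pl; have gl0 := rate_gt0 hg l0.
have eqD : E - l * x = l * ((B - g l * x) / g l).
  by rewrite (ON_power_energy pl); field; rewrite gt_eqF.
have D0 : 0 < E - l * x by rewrite eqD mulr_gt0// divr_gt0//; lra.
apply: ON_power_ex => //; [by lra | by lra |].
have -> : B - g l * x = (E - l * x) * (g l / l).
  by rewrite eqD; field; rewrite !gt_eqF.
by rewrite ler_pM2r// divr_gt0.
Qed.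

Lemma cumul_sub_le t s u l :
  t <= s -> cumul sigma t - u - l * (s - t) <= cumul sigma s - (u + l * (s - t)).
Proof. by move=> /(cumul_le sigma); lra. Qed.

(** Updates never lower the power, so keeping the current one to the end gives an upper bound. *)
Lemma ON_run_le t j u b T : ON_run g B0 sigma t j u b T ->
  counts sigma t j -> b < B0 ->
  forall l, ON_power g (cumul sigma t - u) (B0 - b) l ->
  T <= t + (B0 - b) / g l.
Proof.
elim=> {t j u b T} [t j u b l T pl tT bT _|t j u b l T pl aj bj _ IH] tj bB l' pl'.
  have <- : l = l' by apply: ON_power_inj pl pl'; lra.
  have gl0 := rate_gt0 hg (proj1 pl).
  by rewrite -lerBlDl ler_pdivlMr// mulrC; lra.
have <- : l = l' by apply: ON_power_inj pl pl'; lra.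
have gl0 := rate_gt0 hg (proj1 pl).
have t_lt := counts_lt tj aj.
have [||l2 ll2] := ON_power_next (x := instant sigma j - t) pl _ _
  (cumul_sub_le _ _ (ltW t_lt)); [lra | lra |].
have -> : B0 - b - g l * (instant sigma j - t) =
  B0 - (b + g l * (instant sigma j - t)) by lra.
move=> pl2; apply: le_trans (IH (counts_instant aj) bj _ pl2) _.
have gl2 := rate_le hg (ltW (proj1 pl)) ll2.
set b' := b + _ in bj *.
apply: (@le_trans _ _ (instant sigma j + (B0 - b') / g l)).
  by rewrite lerD2l ler_pM2l ?subr_gt0// lef_pV2// posrE; lra.
rewrite le_eqVlt; apply/orP; left; apply/eqP; rewrite /b'.
by field; rewrite gt_eqF.
Qed.

(* The energy used so far was spent at powers at most [l], hence at least as
   efficiently as at [l]; so all of [E] spent at power [l] would send at most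
   [B0] bits, which the offline optimum sends with [E] within time [TO]. *)
Lemma remaining_time_le TO E u b l : 0 < TO -> 0 < E -> 0 <= u ->
  B0 <= capacity (g := g) E TO -> ON_power g (E - u) (B0 - b) l ->
  u * (g l / l) <= b -> (B0 - b) / g l <= TO.
Proof.
move=> TO0 E0 u0 BE pl ub; have [l0 eB] := pl; have gl0 := rate_gt0 hg l0.
have hB : E * (g l / l) <= B0.
  have : B0 - b = (E - u) * (g l / l) by rewrite -eB; field; rewrite gt_eqF.
  by rewrite mulrBl; lra.
have El : E / TO <= l.
  apply: (rate_ratio_le_inv hg (divr_gt0 E0 TO0) l0).
  by rewrite -(ler_pM2l E0) -capacityE//; apply: le_trans BE.
rewrite -eB.
have -> : (E - u) / l * g l / g l = (E - u) / l by field; rewrite !gt_eqF.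
rewrite ler_pdivrMr//; move: El; rewrite ler_pdivrMr//; lra.
Qed.

(** Induction on the run. The last premise is the invariant: the energy [u] was spent at least as
    efficiently as at the power computed now. The capacity premise is called only at the last update
    before [TO]. *)
Lemma ON_run_lt TO t j u b T : 0 < TO ->
  (forall t j, 0 <= t -> t < TO -> counts sigma t j ->
    (arrival sigma j -> TO <= instant sigma j) ->
    B0 <= capacity (g := g) (cumul sigma t) TO) ->
  ON_run g B0 sigma t j u b T ->
  counts sigma t j -> b < B0 -> 0 <= u -> 0 <= t -> t < TO ->
  (forall l, ON_power g (cumul sigma t - u) (B0 - b) l -> u * (g l / l) <= b) ->
  T < 2 * TO.
Proof.
move=> TO0 hcap; elim=> {t j u b T}
  [t j u b l T pl tT bT jT|t j u b l T pl aj bj run IH] tj bB u0 t0 tTO ub.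
  have gl0 := rate_gt0 hg (proj1 pl).
  case: (leP T TO) => TTO; first by lra.
  have cap := hcap _ _ t0 tTO tj (fun aj => le_trans (ltW TTO) (jT aj)).
  have := remaining_time_le TO0 (cumul_gt0 sigma t0) u0 cap pl (ub _ pl).
  by rewrite ler_pdivrMr//; nra.
have gl0 := rate_gt0 hg (proj1 pl).
have l0 := proj1 pl.
have t_lt := counts_lt tj aj.
(* If the next arrival is not before [TO], this update is the last that counts: power [l] alone
   would finish by [t + TO], and [ON_run_le] covers later updates. *)
case: (leP TO (instant sigma j)) => jTO.
  have cap := hcap _ _ t0 tTO tj (fun _ => jTO).
  have := remaining_time_le TO0 (cumul_gt0 sigma t0) u0 cap pl (ub _ pl).
  have := ON_run_le (ON_update pl aj bj run) tj bB pl; lra.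
have x0 : 0 < instant sigma j - t by rewrite subr_gt0.
apply: IH => //.
- exact: counts_instant aj.
- by apply: addr_ge0 => //; apply: mulr_ge0; lra.
- lra.
(* The invariant survives: since [l <= l2], both the earlier energy [u] and the energy just spent at
   [l] were used at least as efficiently as at [l2]. *)
move=> l2 pl2; have l20 := proj1 pl2.
have ll2 : l <= l2.
  apply: (ON_power_le (x := instant sigma j - t) pl _
    (cumul_sub_le u l (ltW t_lt))); first by lra.
  have -> // : B0 - b - g l * (instant sigma j - t) =
    B0 - (b + g l * (instant sigma j - t)) by lra.
have h2 := rate_ratio_le hg l0 ll2.
have -> : g l * (instant sigma j - t) = l * (instant sigma j - t) * (g l / l).
  by field; rewrite gt_eqF.
rewrite mulrDl lerD//.
  by apply: le_trans (ub _ pl); rewrite ler_wpM2l.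
by rewrite ler_wpM2l// mulr_ge0; lra.
Qed.

(** [F] bounds the finish at the current power throughout, so only arrivals of index below [N] can
    interrupt; [n] bounds how many of them remain. *)
Lemma ON_run_ex F N : ~~ (arrival sigma N && (instant sigma N <= F)) ->
  forall n t j u b l, (N <= n + j)%N -> counts sigma t j -> b < B0 ->
  ON_power g (cumul sigma t - u) (B0 - b) l -> t + (B0 - b) / g l <= F ->
  exists T, ON_run g B0 sigma t j u b T.
Proof.
move=> hN n t j u b l; elim: n t j u b l => [|n IH] t j u b l Nj tj bB pl tF;
  have gl0 := rate_gt0 hg (proj1 pl);
  have [/andP[aj jF]|Fj] := boolP (arrival sigma j &&
    (instant sigma j < t + (B0 - b) / g l)).
- exfalso; move/negP: hN; apply; rewrite add0n in Nj.
  rewrite (arrival_le Nj aj) (le_trans (instant_le Nj aj))//.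
  exact: le_trans (ltW jF) tF.
- exists (t + (B0 - b) / g l); apply: (ON_finish pl).
  + by rewrite lerDl divr_ge0//; lra.
  + by field; rewrite gt_eqF.
  + by move=> aj; rewrite leNgt; apply: contra Fj => ->; rewrite aj.
- have t_lt := counts_lt tj aj.
  have bj : b + g l * (instant sigma j - t) < B0.
    by move: jF; rewrite -ltrBlDl ltr_pdivlMr// mulrC; lra.
  have [||l2 ll2] := ON_power_next (x := instant sigma j - t) pl _ _
    (cumul_sub_le _ _ (ltW t_lt)); [lra | lra |].
  have -> : B0 - b - g l * (instant sigma j - t) =
    B0 - (b + g l * (instant sigma j - t)) by lra.
  move=> pl2; have [||T run] := IH _ _ _ _ _ _ (counts_instant aj) bj pl2.
  + by rewrite addnS -addSn.
  + apply: le_trans tF; have gl2 := rate_le hg (ltW (proj1 pl)) ll2.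
    apply: (@le_trans _ _ (instant sigma j +
      (B0 - (b + g l * (instant sigma j - t))) / g l)).
      by rewrite lerD2l ler_pM2l ?subr_gt0// lef_pV2// posrE; lra.
    rewrite le_eqVlt; apply/orP; left; apply/eqP.
    by field; rewrite gt_eqF.
  + by exists T; apply: ON_update pl aj bj run.
- exists (t + (B0 - b) / g l); apply: (ON_finish pl).
  + by rewrite lerDl divr_ge0//; lra.
  + by field; rewrite gt_eqF.
  + by move=> aj; rewrite leNgt; apply: contra Fj => ->; rewrite aj.
Qed.

End Online.

(** * The start of ON and the constraints met by feasible policies *)

Section Start.
Context {R : realType} {g : R -> R} {B0 : R} {sigma rho : arrivals R}.
Implicit Types (t T : R) (P : policy R).

(** The infimum is attained: by right-continuity, points of the set close enough to it have the same
    cumulated amounts. *)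
Lemma is_start_time_ex t : 0 <= t ->
  B0 <= cumul rho t * g (cumul sigma t / cumul rho t) ->
  exists Ts, is_start_time g B0 sigma rho Ts.
Proof.
move=> t0 Bt; set S : set R := [set s | 0 <= s /\
  cumul rho s * g (cumul sigma s / cumul rho s) >= B0]%classic.
have St : S t by [].
have Slb : has_lbound S by exists 0 => s [].
have S0 : has_inf S by split=> //; exists t.
exists (inf S); split; last exact: ge_inf.
have [t1 lt1 c1] := cumul_right sigma (inf S).
have [t2 lt2 c2] := cumul_right rho (inf S).
have [|s Ss] := @inf_adherent _ S (Num.min t1 t2 - inf S) _ S0.
  by rewrite subr_gt0 lt_min lt1.
rewrite addrC subrK lt_min => /andP[s1 s2].
have Is := ge_inf Slb Ss.
have [s0 Bs] := Ss; split; first by apply: lb_le_inf => [|x []//]; exists t.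
by rewrite -(c1 _ Is s1) -(c2 _ Is s2).
Qed.

Hypothesis hg : rate_function g.

Lemma feasible_capacity P : feasible g B0 sigma rho P ->
  B0 <= capacity (g := g) (energy_used P (finish_time P))
    (on_time_used P (finish_time P)).
Proof. by move=> [<- _]; exact: bits_sent_capacity. Qed.

Lemma feasible_finish_gt0 P : 0 < B0 -> feasible g B0 sigma rho P ->
  0 < finish_time P.
Proof.
move=> hB0 fP; rewrite ltNge; apply/negP => T0.
have := le_trans (feasible_capacity fP)
  (capacity_le hg (energy_used_ge0 _ _) (lexx _) (on_time_used_ge0 _ _)
     (le_trans (on_time_used_le P) T0)).
by rewrite /capacity mul0r leNgt hB0.
Qed.

(* The energy and on-time used vary continuously, so arrivals at the very
   finish time are useless. *)
Lemma feasible_start P : 0 < B0 -> feasible g B0 sigma rho P ->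
  exists2 t, 0 <= t < finish_time P &
    B0 <= cumul rho t * g (cumul sigma t / cumul rho t).
Proof.
move=> hB0 fP; have T0 := feasible_finish_gt0 hB0 fP; set T := finish_time P in T0 *.
have [t1 /andP[t10 t1T] c1] := cumul_left sigma T0.
have [t2 /andP[t20 t2T] c2] := cumul_left rho T0.
have mT : Num.max t1 t2 < T by rewrite gt_max t1T.
have m1 : t1 <= Num.max t1 t2 by rewrite le_max lexx.
have m2 : t2 <= Num.max t1 t2 by rewrite le_max lexx orbT.
have m0 : 0 <= Num.max t1 t2 := le_trans t10 m1.
exists (Num.max t1 t2); first by rewrite m0 mT.
apply: le_trans (feasible_capacity fP) _.
apply: (capacity_le hg (energy_used_ge0 _ _) _ (on_time_used_ge0 _ _)).
  apply: (energy_used_left mT) => s ms sT.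
  have sP : 0 <= s <= T by rewrite (le_trans m0 ms) ltW.
  rewrite (c1 _ m1 mT) -(c1 s) ?(le_trans m1 ms)//.
  exact: (proj1 (proj2 fP s sP)).
apply: (on_time_used_left mT) => s ms sT.
have sP : 0 <= s <= T by rewrite (le_trans m0 ms) ltW.
rewrite (c2 _ m2 mT) -(c2 s) ?(le_trans m2 ms)//.
exact: (proj2 (proj2 fP s sP)).
Qed.

(** No energy arrives strictly between [t] and the finish, so by left limits all the energy spent
    was available at [t]; the on-time is at most the finish time. *)
Lemma feasible_capacity_cumul P t j : feasible g B0 sigma rho P ->
  0 <= t -> t < finish_time P -> counts sigma t j ->
  (arrival sigma j -> finish_time P <= instant sigma j) ->
  B0 <= capacity (g := g) (cumul sigma t) (finish_time P).
Proof.
move=> fP t0 tT tj Tj; apply: le_trans (feasible_capacity fP) _.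
apply: (capacity_le hg (energy_used_ge0 _ _) _ (on_time_used_ge0 _ _)
  (on_time_used_le P)).
apply: (energy_used_left tT) => s ts sT.
rewrite -(cumul_stable tj ts) => [|aj]; last exact: lt_le_trans (Tj aj).
by apply: (proj1 (proj2 fP s _)); rewrite (le_trans t0 ts) ltW.
Qed.

End Start.

(** * Termination of ON and the bound on the ratio *)

Theorem theorem4 (R : realType) (g : R -> R) (hg : rate_function g)
    (B0 : R) (hB0 : 0 < B0) (sigma rho : arrivals R) (TO : R)
    (hTO : is_offline_time g B0 sigma rho TO) :
  (exists TON, is_ON_time g B0 sigma rho TON) /\
  (forall TON, is_ON_time g B0 sigma rho TON -> TON / TO < 2).
Proof.
have [[P fP <-] _] := hTO.
have T0 := feasible_finish_gt0 hg hB0 fP.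
have [t /andP[t0 tT] Bt] := feasible_start hg hB0 fP.
split.
  have [Ts Ts_start] := is_start_time_ex t0 Bt.
  have [[Ts0 BTs] _] := Ts_start.
  have [j cj] := counts_ex sigma Ts.
  have E0 := cumul_gt0 sigma Ts0; have C0 := cumul_gt0 rho Ts0.
  (* At the power energy over on-time, the condition to solve from is exactly the one that defines
     the start time. *)
  have [|l _ pl] := ON_power_ex hg (divr_gt0 E0 C0) E0 hB0.
    by rewrite -capacityE.
  rewrite -[cumul _ _]subr0 -[B0]subr0 in pl.
  have [N hN] := arrival_bounded sigma (Ts + (B0 - 0) / g l).
  have [T run] := ON_run_ex hg hN (leq_addr j N) cj hB0 pl (lexx _).
  exists T, Ts, j; split=> //.
    by move=> i ai; rewrite -cj ai.
  by move=> i; exact: counts_arrival cj.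
move=> TON [Ts [j [[[Ts0 _] minTs] cj aj run]]].
rewrite ltr_pdivrMr//.
have cTs : counts sigma Ts j.
  by move=> i; apply/andP/idP => [[ai]|ij]; [rewrite cj | rewrite cj ?aj].
apply: (ON_run_lt hg T0 _ run cTs hB0 (lexx 0) Ts0).
- by move=> s i s0 sT; exact: feasible_capacity_cumul fP s0 sT.
- by apply: le_lt_trans tT; apply: minTs.
(* At the start nothing is spent or sent, so the efficiency invariant reads [0 <= 0]. *)
- by move=> l _; rewrite mul0r.
Qed.
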